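(* For every non-negative integer $M$, $$\sum_{m,n\geq 0} \frac{q^{Q(m,n)+m+3n}(q^3;q^3)_M}{(q;q)_m (q^3;q^3)_n(q^3;q^3)_{M-2n-m}} +\sum_{m,n\geq 0} \frac{q^{Q(m,n)+3m+6n+1}(q^3;q^3)_M}{(q;q)_m (q^3;q^3)_n(q^3;q^3)_{M-2n-m}}= \sum_{j=-M-1}^M q^{3j^2+2j} {2M+1\brack M-j}_{q^3},$$ where $Q(m,n)=2m^2+6mn+6n^2$.
   Context: $(a;p)_n=\prod_{i=0}^{n-1}(1-ap^i)$ for $n\ge 0$; $1/(p;p)_k=0$ for negative $k$. ${m+n\brack m}_p=\frac{(p;p)_{m+n}}{(p;p)_m(p;p)_n}$ for $m,n\ge0$ and $0$ otherwise. *)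

(* Defs.v *)
From HB Require Import structures.
From mathcomp Require Import all_boot all_order all_algebra.
From mathcomp Require Import boolp classical_sets functions cardinality fsbigop.

Set Implicit Arguments.
Unset Strict Implicit.
Unset Printing Implicit Defensive.

Import Order.TTheory GRing.Theory Num.Theory.
Local Open Scope ring_scope.

(* (a; p)_n *)
Definition qpoch (F : fieldType) (a p : F) (n : nat) : F :=
  \prod_(i < n) (1 - a * p ^+ i).

(* 1 / (p; p)_k for an integer k, with value 0 when k is negative. *)
Definition qfact_inv (F : fieldType) (p : F) (k : int) : F :=
  match k with
  | Posz n => (qpoch p p n)^-1
  | Negz _ => 0
  end.

(* The p-binomial coefficient with upper entry N and lower entry k; it is 0
   unless both k and N - k are non-negative. *)
Definition qbinom (F : fieldType) (p : F) (N k : int) : F :=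
  match k, N - k with
  | Posz m, Posz n => qpoch p p (m + n) / (qpoch p p m * qpoch p p n)
  | _, _ => 0
  end.

Definition Q (m n : nat) : nat :=
  (2 * m ^ 2 + 6 * m * n + 6 * n ^ 2)%N.

(* Main.v *)
(* Put p = q^3 and, for a power series f, let
     T f = sum_r p^C(r+1,2) (p;p)_M / (p;p)_(M-r) [z^r] f.
   With r = m + 2n the exponents of q split off p^C(r+1,2), so the left-hand
   side is T applied to
     (-z;q)_oo / (z^2;p)_oo + q (-q^2 z;q)_oo / (p z^2;p)_oo.
   On the right, splitting 2M+1 = M + (M+1) by q-Vandermonde and using Pascal's
   rule gives S(q^2) + q S(1/q), where
     S(x) = sum_(a,k) [M,a][M,k] p^(a^2-ak+k^2+k) x^(a-k).
   Two more Vandermonde summations give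
     S(x) = T ((-pz;p)_oo (-xz;p)_oo (-pz/x;p)_oo / (z^2;p)_oo).
   Since (-wz;q)_oo = (-wz;p)_oo (-wqz;p)_oo (-wq^2 z;p)_oo, both arguments of T
   are equal to (1+q)(1+z) (-q^2 z;q)_oo / (z^2;p)_oo.  Negative powers of q
   occur on the way, so q = 0 is treated apart. *)

Require Import Defs.
From HB Require Import structures.
From mathcomp Require Import all_boot all_order all_algebra.
From mathcomp Require Import ring zify.
From mathcomp Require Import boolp classical_sets functions cardinality fsbigop.
Set Implicit Arguments.
Unset Strict Implicit.
Unset Printing Implicit Defensive.

Import Order.TTheory GRing.Theory Num.Theory.
Local Open Scope classical_set_scope.
Local Open Scope ring_scope.

(** * Formal power series under the Cauchy product, and finite sums against a weight *)

Definition fps (F : fieldType) : Type := nat -> F.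

Section PowerSeries.
Variable F : fieldType.

(* [fps F] is an alias of [nat -> F] so that its product can be the Cauchy
   product rather than the pointwise one. *)
HB.instance Definition _ := GRing.Zmodule.copy (fps F) (nat -> F).

Implicit Types f g h : fps F.

Lemma fpsD f g n : (f + g) n = f n + g n.
Proof. by []. Qed.

Lemma fpsN f n : (- f) n = - f n.
Proof. by []. Qed.

Definition fps_mul f g : fps F := fun n => \sum_(i < n.+1) f i * g (n - i)%N.

Definition fps_const (c : F) : fps F := fun n => if n is 0 then c else 0.

Definition fps_trunc N f : {poly F} := \poly_(i < N.+1) f i.

(** Only coefficients of index at most n enter the n-th one of a product, so the ring laws are
    inherited from [{poly F}] through truncations. *)
Lemma fps_mul_coef (P Q : {poly F}) f g n :
  (forall i, (i <= n)%N -> P`_i = f i) -> (forall i, (i <= n)%N -> Q`_i = g i) ->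
  fps_mul f g n = (P * Q)`_n.
Proof.
move=> Pf Qg; rewrite coefM; apply: eq_bigr => i _.
by rewrite Pf ?Qg ?leq_subr // -ltnS.
Qed.

Lemma fps_truncE N f i : (i <= N)%N -> (fps_trunc N f)`_i = f i.
Proof. by move=> le_iN; rewrite coef_poly ltnS le_iN. Qed.

Lemma fps_mul_trunc f g n i : (i <= n)%N ->
  (fps_trunc n f * fps_trunc n g)`_i = fps_mul f g i.
Proof.
move=> le_in; symmetry.
by apply: fps_mul_coef => j le_ji; rewrite fps_truncE // (leq_trans le_ji).
Qed.

Lemma fps_mulA : associative fps_mul.
Proof.
move=> f g h; apply/funext => n.
rewrite (@fps_mul_coef (fps_trunc n f) (fps_trunc n g * fps_trunc n h)).
- rewrite mulrA; symmetry; apply: fps_mul_coef => i le_in; last exact: fps_truncE.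
  exact: fps_mul_trunc.
- by move=> i; exact: fps_truncE.
- by move=> i; exact: fps_mul_trunc.
Qed.

Lemma fps_mulC : commutative fps_mul.
Proof. by move=> f g; apply/funext => n; rewrite -!(@fps_mul_trunc _ _ n) // mulrC. Qed.

Lemma fps_mul_const c f n : fps_mul (fps_const c) f n = c * f n.
Proof.
rewrite /fps_mul big_ord_recl subn0 /= big1 ?addr0 // => i _.
by rewrite mul0r.
Qed.

Lemma fps_mul1 : left_id (fps_const 1) fps_mul.
Proof. by move=> f; apply/funext => n; rewrite fps_mul_const mul1r. Qed.

Lemma fps_mulDl : left_distributive fps_mul +%R.
Proof.
move=> f g h; apply/funext => n; rewrite fpsD /fps_mul -big_split.
by apply: eq_bigr => i _; rewrite fpsD mulrDl.
Qed.

Lemma fps_1neq0 : fps_const 1 != 0.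
Proof.
apply/eqP => /(congr1 (fun f : fps F => f 0%N)) /= /eqP.
by rewrite oner_eq0.
Qed.

HB.instance Definition _ := GRing.Zmodule_isComNzRing.Build (fps F)
  fps_mulA fps_mulC fps_mul1 fps_mulDl fps_1neq0.

Lemma fpsM f g n : (f * g) n = \sum_(i < n.+1) f i * g (n - i)%N.
Proof. by []. Qed.

Lemma fpsCM c f n : (fps_const c * f) n = c * f n.
Proof. exact: fps_mul_const. Qed.

Lemma fps_constM c d : fps_const (c * d) = fps_const c * fps_const d.
Proof. by apply/funext => -[|n]; rewrite fpsCM //= mulr0. Qed.

Lemma fps_const1 : fps_const 1 = 1.
Proof. by []. Qed.

Definition fpsX : fps F := fun n => (n == 1%N)%:R.

Lemma fpsXM0 f : (fpsX * f) 0%N = 0.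
Proof. by rewrite fpsM big_ord1 mul0r. Qed.

Lemma fpsXMS f n : (fpsX * f) n.+1 = f n.
Proof.
rewrite fpsM 2!big_ord_recl big1 /= => [|i _]; last by rewrite mul0r.
by rewrite mul0r mul1r add0r addr0 /bump /= subSS subn0.
Qed.

(** The substitution of c z for z. *)
Definition fps_scale (c : F) f : fps F := fun n => c ^+ n * f n.

Lemma fps_scaleM c f g : fps_scale c (f * g) = fps_scale c f * fps_scale c g.
Proof.
apply/funext => n; rewrite /fps_scale !fpsM mulr_sumr; apply: eq_bigr => i _.
by rewrite -{1}(subnKC (ltn_ord i : (i <= n)%N)) exprD; ring.
Qed.

Lemma fps_scaleA c d f : fps_scale c (fps_scale d f) = fps_scale (c * d) f.
Proof. by apply/funext => n; rewrite /fps_scale exprMn mulrA. Qed.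

Lemma fps_scale1 f : fps_scale 1 f = f.
Proof. by apply/funext => n; rewrite /fps_scale expr1n mul1r. Qed.

Definition fps_lin (c : F) : fps F := 1 + fps_const c * fpsX.

Lemma fps_linM0 c f : (fps_lin c * f) 0%N = f 0%N.
Proof. by rewrite /fps_lin mulrDl mul1r fpsD -mulrA fpsCM fpsXM0 mulr0 addr0. Qed.

Lemma fps_linMS c f n : (fps_lin c * f) n.+1 = f n.+1 + c * f n.
Proof. by rewrite /fps_lin mulrDl mul1r fpsD -mulrA fpsCM fpsXMS. Qed.

(** The equation f(z) = A(z) f(pz) with A(0) = 1 expresses (1 - p^n) times the n-th coefficient
    through earlier ones. As 1 - p^n is invertible for n > 0, the constant term decides the
    series. *)
Lemma fps_scale_uniq (p : F) (A f g : fps F) :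
  (forall k, (0 < k)%N -> p ^+ k != 1) -> A 0%N = 1 -> f 0%N = g 0%N ->
  f = A * fps_scale p f -> g = A * fps_scale p g -> f = g.
Proof.
move=> hp A0 fg0 fE gE; apply/funext => n.
have [m] := ubnP n; elim: m n => // m IHm [|n] lt_nm //.
have key h : h = A * fps_scale p h ->
    (1 - p ^+ n.+1) * h n.+1 =
    \sum_(i < n.+1) A i.+1 * (p ^+ (n - i) * h (n - i)%N).
  move=> hE; rewrite mulrBl mul1r {1}hE fpsM big_ord_recl A0 mul1r subn0 {1}/fps_scale.
  by rewrite addrC addKr; apply: eq_bigr => i _; rewrite /fps_scale /= subSS.
have nz : 1 - p ^+ n.+1 != 0 by rewrite subr_eq0 eq_sym hp.
apply: (mulfI nz); rewrite !key //; apply: eq_bigr => i _.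
by rewrite IHm // (leq_ltn_trans (leq_subr _ _)).
Qed.

(** Substitute j = a - s; the terms with j >= N - s that the shift loses are zero by hypothesis. *)
Lemma sum_ord_shift N s (G : nat -> F) :
  (s <= N)%N -> (forall j, (N <= j + s)%N -> G j = 0) ->
  \sum_(a < N | (s <= a)%N) G (a - s)%N = \sum_(a < N) G a.
Proof.
move=> le_sN G0.
rewrite -(big_mkord (fun a => s <= a)%N (fun a => G (a - s)%N)).
rewrite -(big_mkord predT G).
rewrite big_mkcond (big_cat_nat (n := s)) //=.
rewrite big_nat_cond big1 ?add0r; last first.
  by move=> r /andP[/andP[_ lt_rs] _]; rewrite leqNgt lt_rs.
rewrite -{1}[s]add0n big_addn.
rewrite [RHS](big_cat_nat (n := (N - s)%N)) ?leq_subr //=.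
rewrite [X in _ = _ + X]big_nat_cond [X in _ = _ + X]big1 ?addr0; last first.
  by move=> j /andP[/andP[le_j _] _]; rewrite G0 // addnC -leq_subLR.
by apply: eq_bigr => j _; rewrite leq_addl addnK.
Qed.

(** Since [t] vanishes from [N] on, the triangle i + j < N may be enlarged to a square, which
    decouples the indices. *)
Lemma sum_weight_mul (t : nat -> F) N f g :
  (forall r, (N <= r)%N -> t r = 0) ->
  \sum_(r < N) t r * (f * g) r =
  \sum_(i < N) f i * \sum_(j < N) t (i + j)%N * g j.
Proof.
move=> t0.
transitivity (\sum_(i < N) \sum_(r < N | (i <= r)%N) f i * (t r * g (r - i)%N)).
  rewrite (exchange_big_dep predT) //=; apply: eq_bigr => r _.
  rewrite fpsM mulr_sumr (big_ord_widen N (fun i => t r * (f i * g (r - i)%N))) //.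
  by apply: eq_bigr => i _; ring.
apply: eq_bigr => i _; rewrite -mulr_sumr; congr (_ * _).
rewrite -(@sum_ord_shift N i (fun j => t (i + j)%N * g j)) ?(ltnW (ltn_ord i)) //.
  by apply: eq_bigr => r le_ir; rewrite subnKC.
by move=> j le_N; rewrite addnC t0 ?mul0r.
Qed.

Lemma sum_ord_shift2 N (g : nat -> nat -> nat -> F) :
  (forall i j s, (N <= i + s)%N || (N <= j + s)%N -> g i j s = 0) ->
  \sum_(a < N) \sum_(k < N) \sum_(s < N | (s <= a)%N && (s <= k)%N)
    g (a - s)%N (k - s)%N s =
  \sum_(a < N) \sum_(k < N) \sum_(s < N) g a k s.
Proof.
move=> g0.
transitivity (\sum_(s < N) \sum_(a < N | (s <= a)%N) \sum_(k < N | (s <= k)%N)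
    g (a - s)%N (k - s)%N s).
  rewrite [RHS](exchange_big_dep predT) //=; apply: eq_bigr => a _.
  by rewrite [RHS](exchange_big_dep predT).
transitivity (\sum_(s < N) \sum_(a < N) \sum_(k < N) g a k s); last first.
  rewrite exchange_big; apply: eq_bigr => a _; exact: exchange_big.
apply: eq_bigr => s _; have le_sN := ltnW (ltn_ord s).
rewrite (@sum_ord_shift N s (fun a => \sum_(k < N | (s <= k)%N) g a (k - s)%N s)) //.
  apply: eq_bigr => a _; rewrite (@sum_ord_shift N s (fun k => g a k s)) //.
  by move=> j le_N; rewrite g0 ?le_N ?orbT.
by move=> j le_N; rewrite big1 // => k _; rewrite g0 ?le_N.
Qed.

End PowerSeries.

Arguments fpsX {F}.

Lemma binD2 a b : 'C(a + b, 2) = ('C(a, 2) + 'C(b, 2) + a * b)%N.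
Proof.
elim: a => [|a IHa]; first by rewrite bin0n add0n mul0n addn0.
by rewrite addSn !binS !bin1 IHa; lia.
Qed.

(** With this, [lia] can compare quadratic exponents, squares and binomials being atoms of a linear
    identity. *)
Lemma mulnn_bin2 a : (a * a = 'C(a, 2).*2 + a)%N.
Proof. by elim: a => // a IHa; rewrite binS bin1; lia. Qed.

(** * Euler's series, Gaussian binomials and q-Vandermonde *)

Section QSeries.
Variables (F : fieldType) (p : F).
Hypothesis hp : forall k : nat, (0 < k)%N -> p ^+ k != 1.

Lemma qpochS n : qpoch p p n.+1 = qpoch p p n * (1 - p ^+ n.+1).
Proof. by rewrite /qpoch big_ord_recr /= exprS. Qed.

Lemma qpoch0 : qpoch p p 0 = 1.
Proof. by rewrite /qpoch big_ord0. Qed.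

Lemma qpoch_neq0 n : qpoch p p n != 0.
Proof.
elim: n => [|n IHn]; first by rewrite qpoch0 oner_neq0.
by rewrite qpochS mulf_neq0 // subr_eq0 eq_sym hp.
Qed.

Lemma subr_expp_neq0 n : 1 - p ^+ n.+1 != 0.
Proof. by rewrite subr_eq0 eq_sym hp. Qed.

(* [(-w z; p)_oo] *)
Definition qexp (w : F) : fps F :=
  fun n => p ^+ 'C(n, 2) * w ^+ n / qpoch p p n.

(* [1 / (c z^2; p)_oo] *)
Definition qinv_sq (c : F) : fps F :=
  fun n => if odd n then 0 else c ^+ n./2 / qpoch p p n./2.

Lemma qexp0 w : qexp w 0%N = 1.
Proof. by rewrite /qexp qpoch0 divr1 mulr1. Qed.

Lemma scale_qexp c w : fps_scale c (qexp w) = qexp (c * w).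
Proof. by apply/funext => n; rewrite /fps_scale /qexp exprMn; ring. Qed.

Lemma qexp_lin w : qexp w = fps_lin w * qexp (p * w).
Proof.
apply/funext => -[|n]; first by rewrite fps_linM0 !qexp0.
rewrite fps_linMS /qexp binS bin1 qpochS !exprMn exprD [w ^+ n.+1]exprS.
by field; rewrite qpoch_neq0 subr_expp_neq0.
Qed.

Lemma qinv_sq_lin c : qinv_sq (p * c) = (1 - fps_const c * fpsX ^+ 2) * qinv_sq c.
Proof.
apply/funext => n; rewrite mulrBl mul1r fpsD fpsN expr2 -!mulrA fpsCM.
case: n => [|[|n]].
- by rewrite fpsXM0 /qinv_sq /= !mul1r mulr0 subr0.
- by rewrite fpsXMS fpsXM0 /qinv_sq /= mulr0 subr0.
rewrite !fpsXMS /qinv_sq /= negbK; case: (odd n); first by rewrite mulr0 subr0.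
rewrite qpochS exprMn [c ^+ _]exprS.
by field; rewrite qpoch_neq0 subr_expp_neq0.
Qed.

(** A counterpart of [qbinom] with natural indices, tied to it by [qbinomE]. *)
Definition gauss (a n : nat) : F :=
  if (n <= a)%N then qpoch p p a / (qpoch p p n * qpoch p p (a - n)) else 0.

(* [(-z; p)_a] *)
Definition qprod (a : nat) : fps F := fun n => p ^+ 'C(n, 2) * gauss a n.

Lemma gauss_small a n : (a < n)%N -> gauss a n = 0.
Proof. by move=> lt_an; rewrite /gauss leqNgt lt_an. Qed.

Lemma gauss0 a : gauss a 0 = 1.
Proof. by rewrite /gauss subn0 qpoch0 mul1r divff ?qpoch_neq0. Qed.

Lemma gaussnn a : gauss a a = 1.
Proof. by rewrite /gauss leqnn subnn qpoch0 mulr1 divff ?qpoch_neq0. Qed.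

Lemma gauss_sym a n : (n <= a)%N -> gauss a (a - n) = gauss a n.
Proof. by move=> le_na; rewrite /gauss leq_subr le_na subKn // [_ * qpoch _ _ n]mulrC. Qed.

Lemma gaussS a n : gauss a.+1 n.+1 = p ^+ n.+1 * gauss a n.+1 + gauss a n.
Proof.
case: (ltngtP n a) => [lt_na|lt_an|->].
- have /subnKC <- := lt_na; move: (a - n.+1)%N => b.
  rewrite /gauss !ifT; try lia.
  have -> : (n.+1 + b - n = b.+1)%N by lia.
  have -> : ((n.+1 + b).+1 - n.+1 = b.+1)%N by lia.
  have -> : (n.+1 + b - n.+1 = b)%N by lia.
  rewrite qpochS -addnS exprD; move: (qpoch p p (n.+1 + b)) => D; rewrite !qpochS.
  field; rewrite ?qpoch_neq0 ?subr_expp_neq0 //.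
- by rewrite !gauss_small ?mulr0 ?addr0 ?ltnS // ltnW.
- by rewrite !gaussnn gauss_small ?mulr0 ?add0r.
Qed.

Lemma qprod0 : qprod 0 = 1.
Proof.
apply/funext => -[|n]; rewrite /qprod ?gauss0 ?mulr1 //.
by rewrite gauss_small ?mulr0.
Qed.

Lemma qprodS a : qprod a.+1 = fps_lin 1 * fps_scale p (qprod a).
Proof.
apply/funext => -[|n].
  by rewrite fps_linM0 /qprod /fps_scale !gauss0 !mulr1 !expr0 ?mul1r.
by rewrite fps_linMS /qprod /fps_scale gaussS binS bin1 exprD; ring.
Qed.

Lemma qprodD a b : qprod (a + b) = qprod a * fps_scale (p ^+ a) (qprod b).
Proof.
elim: a => [|a IHa]; first by rewrite add0n qprod0 mul1r fps_scale1.
by rewrite addSn !qprodS IHa fps_scaleM fps_scaleA mulrA -exprS.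
Qed.

Lemma qexp_qprod a : qexp 1 = qprod a * qexp (p ^+ a).
Proof.
elim: a => [|a IHa]; first by rewrite qprod0 mul1r.
rewrite qprodS qexp_lin -scale_qexp IHa fps_scaleM scale_qexp exprS.
by rewrite mulrA.
Qed.

Hypothesis p0 : p != 0.

(* Coefficient extraction in [(-z)_a (-p^a z)_b = (-z)_(a+b)], after
   cancelling [p^C(k,2)]. *)
Lemma gauss_vandermonde a b k :
  gauss (a + b) k =
  \sum_(s < k.+1) gauss a s * gauss b (k - s) * p ^+ ((a - s) * (k - s)).
Proof.
have := congr1 (fun f : fps F => f k) (qprodD a b).
rewrite fpsM /qprod => E.
have nz : p ^+ 'C(k, 2) != 0 by rewrite expf_neq0.
apply: (mulfI nz); rewrite E mulr_sumr; apply: eq_bigr => s _.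
rewrite /fps_scale -exprM.
(* For s > a the truncated a - s would be wrong, but [gauss] vanishes there. Otherwise the cross
   term s (k - s) of [binD2] reduces a (k - s) to (a - s) (k - s). *)
have [le_sa|lt_as] := leqP s a; last by rewrite gauss_small // !(mul0r,mulr0).
rewrite -[in 'C(k, 2)](subnKC (ltn_ord s : (s <= k)%N)) binD2.
have -> : (a * (k - s) = s * (k - s) + (a - s) * (k - s))%N by rewrite -mulnDl subnKC.
by rewrite !exprD; ring.
Qed.

(** The formal limit of [gauss_vandermonde] as b grows, read off from (-z;p)_oo = (-z;p)_a (-p^a
    z;p)_oo. *)
Lemma inv_qpoch_vandermonde a k :
  (qpoch p p k)^-1 =
  \sum_(s < k.+1) gauss a s / qpoch p p (k - s) * p ^+ ((a - s) * (k - s)).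
Proof.
have := congr1 (fun f : fps F => f k) (qexp_qprod a).
rewrite fpsM /qprod /qexp expr1n mulr1 => E.
have nz : p ^+ 'C(k, 2) != 0 by rewrite expf_neq0.
apply: (mulfI nz); rewrite E mulr_sumr; apply: eq_bigr => s _.
rewrite -exprM.
have [le_sa|lt_as] := leqP s a; last by rewrite gauss_small // !(mul0r,mulr0).
rewrite -[in 'C(k, 2)](subnKC (ltn_ord s : (s <= k)%N)) binD2.
have -> : (a * (k - s) = s * (k - s) + (a - s) * (k - s))%N by rewrite -mulnDl subnKC.
by rewrite !exprD; ring.
Qed.

End QSeries.

(** * Passing between the bases q and p = q^3 *)

Lemma expr3X_neq1 (F : fieldType) (q : F) :
  (forall k : nat, (0 < k)%N -> q ^+ k != 1) ->
  forall k : nat, (0 < k)%N -> (q ^+ 3) ^+ k != 1.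
Proof. by move=> hq k k_gt0; rewrite -exprM hq ?muln_gt0. Qed.

Section CubicBase.
Variables (F : fieldType) (q : F).
Hypothesis hq : forall k : nat, (0 < k)%N -> q ^+ k != 1.
Let p := q ^+ 3.

Let hp := expr3X_neq1 hq.

(** Both sides have constant term 1 and solve f(z) = (1 + wz)(1 + qwz)(1 + q^2 wz) f(pz): the left
    loses three factors in base q, the right one factor from each product in base p. *)
Lemma qexp_trisection w :
  qexp q w = qexp p w * qexp p (q * w) * qexp p (q ^+ 2 * w).
Proof.
apply: (@fps_scale_uniq _ p (fps_lin w * (fps_lin (q * w) * fps_lin (q ^+ 2 * w)))) => //.
- by rewrite -[fps_lin (q ^+ 2 * w)]mulr1 !fps_linM0.
- by rewrite -mulrA fpsM big_ord1 fpsM big_ord1 !qexp0 !mulr1.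
- rewrite scale_qexp (qexp_lin hq) (qexp_lin hq (q * w)) (qexp_lin hq (q * (q * w))).
  have -> : q * (q * w) = q ^+ 2 * w by ring.
  have -> : q * (q ^+ 2 * w) = p * w by rewrite /p; ring.
  by rewrite !mulrA.
- rewrite !fps_scaleM !scale_qexp (qexp_lin hp w) (qexp_lin hp (q * w)).
  by rewrite (qexp_lin hp (q ^+ 2 * w)); ring.
Qed.

Hypothesis q0 : q != 0.

(** The two summands on the right are the series of [gauss_square_sumE] at x = q^2 and x = 1/q. *)
Lemma series_identity :
  qexp q 1 * qinv_sq p 1 + fps_const q * (qexp q (q ^+ 2) * qinv_sq p p) =
  qexp p p * (qexp p (q ^+ 2) * (qexp p (p / q ^+ 2) * qinv_sq p 1)) +
  fps_const q * (qexp p p * (qexp p q^-1 * (qexp p (p / q^-1) * qinv_sq p 1))).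
Proof.
have -> : p / q ^+ 2 = q by rewrite /p; field.
have -> : p / q^-1 = q ^+ 4 by rewrite /p invrK -exprSr.
have -> : qinv_sq p p = (1 - fpsX ^+ 2) * qinv_sq p 1.
  by rewrite -{2}[p]mulr1 (qinv_sq_lin hp) fps_const1 mul1r.
have E1 : qexp q 1 = fps_lin 1 * (fps_lin q * qexp q (q ^+ 2)).
  by rewrite (qexp_lin hq) (qexp_lin hq (q * 1)) !mulr1 -expr2.
have E2 : qexp p q * qexp p (q ^+ 2) * qexp p p = fps_lin q * qexp q (q ^+ 2).
  by rewrite expr2 -(qexp_lin hq) qexp_trisection -expr2 -exprSr.
have E3 : qexp p q^-1 = fps_lin q^-1 * qexp p (q ^+ 2).
  by rewrite (qexp_lin hp); congr (_ * qexp p _); rewrite /p; field.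
have E4 : qexp q (q ^+ 2) = qexp p (q ^+ 2) * qexp p p * qexp p (q ^+ 4).
  by rewrite qexp_trisection -exprS -exprD.
have E5 : fps_const q * fps_lin q^-1 = fps_const q + fpsX.
  by rewrite /fps_lin mulrDr mulr1 mulrA -fps_constM divff // fps_const1 mul1r.
(* On the left the cofactor is (1 + z)(1 + qz) + q (1 - z^2) = (1 + q)(1 + z). *)
transitivity ((1 + fps_const q) * (1 + fpsX) * qexp q (q ^+ 2) * qinv_sq p 1).
  by rewrite E1 /fps_lin fps_const1; ring.
have -> : qexp p p * (qexp p (q ^+ 2) * (qexp p q * qinv_sq p 1)) =
  (fps_lin q * qexp q (q ^+ 2)) * qinv_sq p 1 by rewrite -E2; ring.
have -> : fps_const q * (qexp p p * (qexp p q^-1 * (qexp p (q ^+ 4) * qinv_sq p 1))) =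
  (fps_const q * fps_lin q^-1) * qexp q (q ^+ 2) * qinv_sq p 1 by rewrite E4 E3; ring.
(* On the right it is (1 + qz) + (q + z), the same product. *)
by rewrite E5 /fps_lin; ring.
Qed.

End CubicBase.

(** * The functional T and the double sum S(x) *)

Section Weights.
Variables (F : fieldType) (p : F).
Hypothesis hp : forall k : nat, (0 < k)%N -> p ^+ k != 1.

(** The factor that T puts on the coefficient of z^r. *)
Definition qweight (M r : nat) : F :=
  if (r <= M)%N then p ^+ 'C(r.+1, 2) * (qpoch p p M / qpoch p p (M - r)) else 0.

Lemma qweight_small M r : (M < r)%N -> qweight M r = 0.
Proof. by move=> lt_Mr; rewrite /qweight leqNgt lt_Mr. Qed.

Lemma sum_weight_qinv_sq (t : nat -> F) N i c :
  (forall r, (N <= r)%N -> t r = 0) ->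
  \sum_(j < N) t (i + j)%N * qinv_sq p c j =
  \sum_(n < N) t (i + n.*2)%N * (c ^+ n / qpoch p p n).
Proof.
move=> t0.
(* Doubling the range adds only zero terms and lets the even j = 2n run over exactly n < N; odd j
   contribute nothing. *)
transitivity (\sum_(0 <= j < N.*2) t (i + j)%N * qinv_sq p c j).
  rewrite (big_cat_nat (n := N)) ?leq0n //= -?addnn ?leq_addr //.
  rewrite big_mkord [X in _ = _ + X]big_nat_cond [X in _ = _ + X]big1 ?addr0 //.
  by move=> j /andP[/andP[le_Nj _] _]; rewrite t0 ?mul0r // (leq_trans le_Nj) ?leq_addl.
elim: N {t0} => [|N IHN]; first by rewrite big_nil big_ord0.
rewrite doubleS !big_nat_recr //= IHN big_ord_recr /= -addrA; congr (_ + _).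
by rewrite /qinv_sq /= odd_double /= mulr0 addr0 doubleK.
Qed.

Hypothesis p0 : p != 0.

(* The power of [p] in the denominator only cancels the one in [qweight]. *)
Lemma gauss_mul M N a k : (M < N)%N -> (a <= M)%N -> (k < N)%N ->
  gauss p M a * gauss p M k =
  \sum_(s < N | (s <= a)%N && (s <= k)%N)
    p ^+ ((a - s) * (k - s)) / p ^+ 'C((a - s + (k - s) + s).+1, 2)
    * qweight M (a - s + (k - s) + s)
    / (qpoch p p s * qpoch p p (a - s) * qpoch p p (k - s)).
Proof.
(* Vandermonde with M = a + b is applied to the second factor only. The product [M,a][a,s][b,k-s] is
   then a multinomial whose last denominator is (p;p)_(M-r) with r = a + k - s, the one in
   [qweight]. *)
move=> lt_MN le_aM lt_kN; have /subnKC EM := le_aM; move: (M - a)%N EM => b EM.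
rewrite -{2}EM (gauss_vandermonde hp) // mulr_sumr.
rewrite (big_ord_widen N (fun s =>
  gauss p M a * (gauss p a s * gauss p b (k - s) * p ^+ ((a - s) * (k - s))))) //.
rewrite big_mkcond [RHS]big_mkcond; apply: eq_bigr => s _ /=.
rewrite ltnS andbC; case: (leqP s k) => //= le_sk.
case: leqP => [le_sa|lt_as]; last by rewrite [gauss p a s]gauss_small // !(mul0r, mulr0).
rewrite /qweight {3}/gauss.
have -> : (k - s <= b)%N = (a - s + (k - s) + s <= M)%N by lia.
case: leqP => [le_rM|_]; last by rewrite !(mul0r, mulr0).
have -> : (M - (a - s + (k - s) + s) = b - (k - s))%N by lia.
rewrite /gauss le_aM le_sa -EM addKn.
by field; rewrite !qpoch_neq0 ?expf_neq0.
Qed.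

(* The formal limit of [gauss_mul] as [M] tends to infinity. *)
Lemma inv_qpoch_mul N a k : (k < N)%N ->
  (qpoch p p a * qpoch p p k)^-1 =
  \sum_(s < N | (s <= a)%N && (s <= k)%N)
    p ^+ ((a - s) * (k - s)) / (qpoch p p s * qpoch p p (a - s) * qpoch p p (k - s)).
Proof.
move=> lt_kN; rewrite invfM (inv_qpoch_vandermonde hp p0 a k) mulr_sumr.
rewrite (big_ord_widen N (fun s => (qpoch p p a)^-1 *
  (gauss p a s / qpoch p p (k - s) * p ^+ ((a - s) * (k - s))))) //.
rewrite big_mkcond [RHS]big_mkcond; apply: eq_bigr => s _ /=.
rewrite ltnS andbC; case: (leqP s k) => //= le_sk.
case: leqP => [le_sa|lt_as]; last by rewrite gauss_small // !(mul0r, mulr0).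
by rewrite /gauss le_sa; field; rewrite !qpoch_neq0.
Qed.

(** The sum S(x), with the exponents -ak and a - k written as quotients of natural powers. *)
Definition gauss_square_sum (M : nat) (x : F) : F :=
  \sum_(a < M.+1) \sum_(k < M.+1)
    gauss p M a * gauss p M k *
    (p ^+ (a * a + k * k + k) / p ^+ (a * k) * (x ^+ a / x ^+ k)).

(** [gauss_mul] introduces an index s that becomes the degree in (-pz;p)_oo; [inv_qpoch_mul]
    introduces an index n that becomes half the degree in 1/(z^2;p)_oo. *)
Lemma gauss_square_sumE M x : x != 0 ->
  gauss_square_sum M x =
  \sum_(r < M.+1) qweight M r *
    (qexp p p * (qexp p x * (qexp p (p / x) * qinv_sq p 1))) r.
Proof.
move=> x0; rewrite /gauss_square_sum.
pose t := qweight M.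
have t0 r : (M.+1 <= r)%N -> t r = 0 by exact: qweight_small.
have tD i r : (M.+1 <= r)%N -> t (i + r)%N = 0.
  by move=> le_r; rewrite t0 // (leq_trans le_r) ?leq_addl.
(* The powers of p and x left once the weight and the coefficient of (-pz;p)_oo are split off; they
   do not depend on s. *)
pose u i j : F := p ^+ ('C(i, 2) + 'C(j.+1, 2)) / p ^+ (i * j) * (x ^+ i / x ^+ j).
pose g i j s : F := t (i + j + s)%N * qexp p p s *
  (u i j / (qpoch p p i * qpoch p p j)).
transitivity (\sum_(a < M.+1) \sum_(k < M.+1)
   \sum_(s < M.+1 | (s <= a)%N && (s <= k)%N) g (a - s)%N (k - s)%N s).
  apply: eq_bigr => a _; apply: eq_bigr => k _.
  have le_aM : (a <= M)%N by rewrite -ltnS.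
  rewrite (gauss_mul (ltnSn M) le_aM (ltn_ord k)) mulr_suml; apply: eq_bigr => s.
  case/andP; move: {le_aM} (nat_of_ord a) (nat_of_ord k) (nat_of_ord s) => {}a {}k {}s.
  move=> /subnK <- /subnK <-; move: (a - s)%N (k - s)%N => {}a {}k.
  rewrite !addnK /g /u /qexp -/t; set w := t _.
  (* Exponents balanced without subtraction: one a k comes from [gauss_mul], the other from the
     denominator of [u]. *)
  have EN : ((a + s) * (a + s) + (k + s) * (k + s) + (k + s) + a * k + a * k =
    'C(a, 2) + 'C(k.+1, 2) + (a + s) * (k + s) + 'C((a + k + s).+1, 2) + 'C(s, 2) + s)%N.
    have := mulnn_bin2 s; have := mulnn_bin2 a; have := mulnn_bin2 k.
    by rewrite !binS !bin1 !binD2; lia.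
  have -> : p ^+ ((a + s) * (a + s) + (k + s) * (k + s) + (k + s)) =
    p ^+ ('C(a, 2) + 'C(k.+1, 2) + (a + s) * (k + s) + 'C((a + k + s).+1, 2) + 'C(s, 2) + s)
    / p ^+ (a * k) / p ^+ (a * k).
    by rewrite -EN ![p ^+ (_ + a * k)]exprD; field; rewrite ?expf_neq0.
  rewrite !exprD; field.
  by rewrite !qpoch_neq0 ?expf_neq0.
transitivity (\sum_(a < M.+1) \sum_(k < M.+1) \sum_(s < M.+1) g a k s).
  apply: sum_ord_shift2 => i j s le_M; rewrite /g t0 ?mul0r //.
  by case/orP: le_M => ?; lia.
symmetry; rewrite (sum_weight_mul _ _ t0).
transitivity (\sum_(s < M.+1) qexp p p s * \sum_(i < M.+1) \sum_(j < M.+1)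
  t (i + j + s)%N * (u i j / (qpoch p p i * qpoch p p j))); last first.
  rewrite [RHS](eq_bigr _ (fun a _ => exchange_big _ _ _ _ _ _)) exchange_big.
  apply: eq_bigr => s _; rewrite mulr_sumr; apply: eq_bigr => i _.
  by rewrite mulr_sumr; apply: eq_bigr => j _; rewrite /g; ring.
apply: eq_bigr => s _; congr (_ * _).
rewrite (sum_weight_mul _ _ (tD s)).
pose e i j n : F := t (s + i + j + n.*2)%N * qexp p x i * qexp p (p / x) j / qpoch p p n.
transitivity (\sum_(i < M.+1) \sum_(j < M.+1) \sum_(n < M.+1) e i j n).
  apply: eq_bigr => i _.
  rewrite (@sum_weight_mul _ (fun j => t (s + (i + j))%N)); last first.
    by move=> r le_r; rewrite addnA tD.
  rewrite mulr_sumr; apply: eq_bigr => j _.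
  rewrite (@sum_weight_qinv_sq (fun r => t (s + (i + r))%N)); last first.
    by move=> r le_r; rewrite addnA tD.
  rewrite !mulr_sumr; apply: eq_bigr => n _.
  by rewrite /e expr1n !addnA; ring.
(* Lowering i and j by n makes the total degree s + i + j free of n, so the sum over n is
   [inv_qpoch_mul]. *)
transitivity (\sum_(i < M.+1) \sum_(j < M.+1)
   \sum_(n < M.+1 | (n <= i)%N && (n <= j)%N) e (i - n)%N (j - n)%N n).
  symmetry; apply: sum_ord_shift2 => i j n le_M; rewrite /e t0 ?mul0r //.
  by case/orP: le_M => ?; lia.
apply: eq_bigr => i _; apply: eq_bigr => j _.
rewrite (@inv_qpoch_mul M.+1) // !mulr_sumr; apply: eq_bigr => n.
rewrite /e {e}; case/andP; move: (nat_of_ord i) (nat_of_ord j) (nat_of_ord s) (nat_of_ord n).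
move=> {}i {}j {}s {}n /subnK <- /subnK <-; move: (i - n)%N (j - n)%N => {}i {}j.
rewrite !addnK /u /qexp.
have -> : (s + i + j + n.*2 = i + n + (j + n) + s)%N by lia.
have EN : ('C(i + n, 2) + 'C((j + n).+1, 2) + i * j =
    (i + n) * (j + n) + 'C(i, 2) + 'C(j, 2) + j)%N.
  by rewrite !binS !bin1 !binD2; have := mulnn_bin2 n; lia.
have -> : p ^+ ('C(i + n, 2) + 'C((j + n).+1, 2)) =
    p ^+ ((i + n) * (j + n) + 'C(i, 2) + 'C(j, 2) + j) / p ^+ (i * j).
  by rewrite -EN [p ^+ (_ + i * j)]exprD; field; rewrite ?expf_neq0.
rewrite exprMn exprVn ![p ^+ ((i + n) * (j + n) + _ + _ + _)]exprD !exprD; field.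
by rewrite !qpoch_neq0 ?expf_neq0.
Qed.

End Weights.

(** * Weighted forms of Pascal's rule and of q-Vandermonde *)

Section Vandermonde.
Variables (F : fieldType) (p : F).
Hypothesis hp : forall k : nat, (0 < k)%N -> p ^+ k != 1.
Hypothesis p0 : p != 0.

Lemma sum_gaussS M N (f : nat -> F) : (M < N)%N ->
  \sum_(k < N.+1) f k * gauss p M.+1 k =
  \sum_(k < M.+1) f k * p ^+ k * gauss p M k + \sum_(k < M.+1) f k.+1 * gauss p M k.
Proof.
move=> lt_MN.
have widen n (g : nat -> F) : (M < n)%N ->
    \sum_(k < M.+1) g k * gauss p M k = \sum_(k < n) g k * gauss p M k.
  move=> lt_Mn; rewrite (big_ord_widen n (fun k => g k * gauss p M k)) //.
  rewrite big_mkcond; apply: eq_bigr => k _; rewrite ltnS.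
  by case: leqP => // lt_Mk; rewrite gauss_small ?mulr0.
rewrite (widen N.+1 (fun k => f k * p ^+ k)) ?ltnS ?(ltnW lt_MN) //.
rewrite (widen N (fun k => f k.+1)) // !big_ord_recl !gauss0 // expr0 !mulr1 -addrA.
congr (_ + _); rewrite -big_split; apply: eq_bigr => k _ /=.
by rewrite gaussS // mulrDr mulrA.
Qed.

(** Pairs (-z;p)_(2M+1) = (-z;p)_M (-p^M z;p)_(M+1) with a weight that depends on M - n. *)
Lemma sum_gaussD M (W : int -> F) :
  \sum_(n < M + M.+2) W (M%:Z - n%:Z) * gauss p (M + M.+1) n =
  \sum_(a < M.+1) \sum_(k < M.+2)
    W (a%:Z - k%:Z) * p ^+ (a * k) * gauss p M a * gauss p M.+1 k.
Proof.
set N := (M + M.+2)%N.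
(* The division undoes the power of p in [qprod], and the cutoff provides the vanishing that
   [sum_weight_mul] asks for. *)
pose t n := if (n < N)%N then W (M%:Z - n%:Z) / p ^+ 'C(n, 2) else 0.
have t0 r : (N <= r)%N -> t r = 0 by rewrite /t leqNgt => /negbTE ->.
transitivity (\sum_(n < N) t n * qprod p (M + M.+1) n).
  apply: eq_bigr => n _; rewrite /t ltn_ord /qprod.
  by field; rewrite expf_neq0.
rewrite qprodD // (sum_weight_mul _ _ t0).
transitivity (\sum_(i < M.+1) qprod p M i *
    \sum_(j < N) t (i + j)%N * fps_scale (p ^+ M) (qprod p M.+1) j).
  rewrite [RHS](big_ord_widen N (fun i => qprod p M i *
    \sum_(j < N) t (i + j)%N * fps_scale (p ^+ M) (qprod p M.+1) j)) ?leq_addr //; last first.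
    by rewrite /N; lia.
  rewrite [RHS]big_mkcond; apply: eq_bigr => i _; rewrite ltnS.
  by case: leqP => // lt_Mi; rewrite /qprod gauss_small // mulr0 mul0r.
(* With i = M - a the argument M - (i + k) becomes a - k, and [gauss] is symmetric. *)
rewrite (reindex_inj rev_ord_inj); apply: eq_bigr => a _ /=; rewrite subSS.
have le_aM : (a <= M)%N by rewrite -ltnS.
rewrite mulr_sumr.
rewrite [RHS](big_ord_widen N (fun k => W (a%:Z - k%:Z) * p ^+ (a * k)
  * gauss p M a * gauss p M.+1 k)) ?leq_addl // [RHS]big_mkcond.
apply: eq_bigr => k _; rewrite ltnS /fps_scale /qprod gauss_sym //.
case: leqP => [le_kM|lt_Mk]; last by rewrite [gauss _ _ k]gauss_small // !mulr0.
rewrite /t ifT; last by rewrite /N -addnS leq_add ?leq_subr.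
have -> : M%:Z - (M - a + k)%:Z = a%:Z - k%:Z by rewrite PoszD -subzn //; ring.
have -> : p ^+ M ^+ k = p ^+ ((M - a) * k) * p ^+ (a * k).
  by rewrite -exprM -exprD -mulnDl subnK.
rewrite binD2 !exprD.
by field; rewrite !expf_neq0.
Qed.

End Vandermonde.

(** * The right-hand side as S(q^2) + q S(1/q) *)

Section RightHandSide.
Variables (F : fieldType) (q : F).
Hypothesis hq : forall k : nat, (0 < k)%N -> q ^+ k != 1.
Hypothesis q0 : q != 0.

Lemma expfzB (m n : nat) : q ^ (m%:Z - n%:Z) = q ^+ m / q ^+ n.
Proof. by rewrite expfzDr // -exprnN. Qed.

(** In Pascal's rule the terms that keep k carry q^(2(a-k)), hence x = q^2; those shifted to k + 1
    carry q^(1-(a-k)), hence q times x = 1/q. *)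
Lemma rhs_gauss_square_sum M :
  \sum_(n < M + M.+2) q ^ (3%:Z * (M%:Z - n%:Z) ^+ 2 + 2%:Z * (M%:Z - n%:Z))
    * gauss (q ^+ 3) (M + M.+1) n =
  gauss_square_sum (q ^+ 3) M (q ^+ 2) + q * gauss_square_sum (q ^+ 3) M q^-1.
Proof.
have hp := expr3X_neq1 hq.
have p0 : q ^+ 3 != 0 by rewrite expf_neq0.
rewrite (sum_gaussD hp p0 M (fun j => q ^ (3%:Z * j ^+ 2 + 2%:Z * j))).
rewrite /gauss_square_sum mulr_sumr -big_split; apply: eq_bigr => a _ /=.
rewrite (sum_gaussS hp (fun k => q ^ (3%:Z * (a%:Z - k%:Z) ^+ 2 + 2%:Z * (a%:Z - k%:Z))
  * (q ^+ 3) ^+ (a * k) * gauss (q ^+ 3) M a) (ltnSn M)) mulr_sumr.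
congr (_ + _); apply: eq_bigr => k _.
  have -> : 3%:Z * (a%:Z - k%:Z) ^+ 2 + 2%:Z * (a%:Z - k%:Z) =
    (3 * (a * a) + 3 * (k * k) + 2 * a)%N%:Z - (3 * (a * k) + 3 * (a * k) + 2 * k)%N%:Z.
    by rewrite !PoszD !PoszM; ring.
  rewrite expfzB -!exprM !mulnDr !exprD.
  by field; rewrite ?expf_neq0.
have -> : 3%:Z * (a%:Z - k.+1%:Z) ^+ 2 + 2%:Z * (a%:Z - k.+1%:Z) =
  (3 * (a * a) + 3 * (k * k) + 4 * k + 1)%N%:Z - (3 * (a * k) + 3 * (a * k) + 4 * a)%N%:Z.
  by rewrite -addn1 !PoszD !PoszM; ring.
rewrite expfzB -!exprM mulnS !mulnDr !exprD !exprVn expr1.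
by field; rewrite ?expf_neq0 ?oner_neq0.
Qed.

End RightHandSide.

(** * From sums over infinite or integer index sets to sums over ordinals *)

Section FiniteSums.
Variable F : fieldType.

Lemma fsum_nat N (f : nat -> F) : (forall n, (N <= n)%N -> f n = 0) ->
  \sum_(n \in [set: nat]) f n = \sum_(n < N) f n.
Proof.
move=> f0; rewrite fsbig_ord; symmetry; apply: fsbig_widen => // n [_ /= nN].
by apply: f0; rewrite leqNgt; apply/negP.
Qed.

Lemma qfact_invE (p : F) (M m n : nat) :
  qfact_inv p (M%:Z - 2%:Z * n%:Z - m%:Z) =
  if (m + n.*2 <= M)%N then (qpoch p p (M - (m + n.*2)))^-1 else 0.
Proof.
case: leqP => [le_M|lt_M].
  have -> : M%:Z - 2%:Z * n%:Z - m%:Z = (M - (m + n.*2))%N%:Z by lia.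
  by [].
have -> : M%:Z - 2%:Z * n%:Z - m%:Z = Negz (m + n.*2 - M).-1 by lia.
by [].
Qed.

Lemma fsum_qfact_inv (p : F) (M : nat) (f : nat -> nat -> F) :
  \sum_(m \in [set: nat]) \sum_(n \in [set: nat])
     (f m n * qfact_inv p (M%:Z - 2%:Z * n%:Z - m%:Z)) =
  \sum_(m < M.+1) \sum_(n < M.+1) (f m n * qfact_inv p (M%:Z - 2%:Z * n%:Z - m%:Z)).
Proof.
rewrite (@fsum_nat M.+1) => [|m lt_Mm]; last first.
  rewrite (@fsum_nat 0) ?big_ord0 // => n _; rewrite qfact_invE.
  by rewrite leqNgt (leq_trans lt_Mm) ?leq_addr ?mulr0.
apply: eq_bigr => m _; apply: fsum_nat => n lt_Mn; rewrite qfact_invE.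
by case: leqP => [|_]; rewrite ?mulr0 //; lia.
Qed.

Lemma qbinomE (p : F) (M n : nat) : (n < M + M.+2)%N ->
  qbinom p (2%:Z * M%:Z + 1) n%:Z = gauss p (M + M.+1) n.
Proof.
move=> lt_n; rewrite /qbinom /gauss ifT; last by lia.
have -> : 2%:Z * M%:Z + 1 - n%:Z = (M + M.+1 - n)%N%:Z by lia.
by rewrite subnKC //; lia.
Qed.

(** The map n -> M - n is a bijection from 0 <= n <= 2M + 1 onto -M - 1 <= j <= M. *)
Lemma fsum_qbinom (p : F) (M : nat) (W : int -> F) :
  \sum_(j \in [set j : int | - M%:Z - 1 <= j <= M%:Z])
     (W j * qbinom p (2%:Z * M%:Z + 1) (M%:Z - j)) =
  \sum_(n < M + M.+2) W (M%:Z - n%:Z) * gauss p (M + M.+1) n.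
Proof.
rewrite (reindex_fsbig (fun n : nat => M%:Z - n%:Z) `I_(M + M.+2)); last first.
  split=> [n /= lt_n|i j _ _ /= ij|j /= bj].
  - by apply/andP; split; lia.
  - by lia.
  - by exists `|M%:Z - j|%N => /=; lia.
rewrite -fsbig_ord; apply: eq_bigr => n _.
by rewrite subKr qbinomE.
Qed.

End FiniteSums.

(** * The left-hand side as values of T *)

Section LeftHandSide.
Variables (F : fieldType) (q : F).
Hypothesis hq : forall k : nat, (0 < k)%N -> q ^+ k != 1.
Let p := q ^+ 3.

Let hp := expr3X_neq1 hq.

Lemma sum_qweight_double M w c :
  \sum_(r < M.+1) qweight p M r * (qexp q w * qinv_sq p c) r =
  \sum_(m < M.+1) \sum_(n < M.+1)
    (q ^+ (3 * 'C((m + n.*2).+1, 2) + 'C(m, 2)) * w ^+ m * c ^+ n * qpoch p p M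
     / (qpoch q q m * qpoch p p n)) * qfact_inv p (M%:Z - 2%:Z * n%:Z - m%:Z).
Proof.
have t0 r : (M.+1 <= r)%N -> qweight p M r = 0 by exact: qweight_small.
rewrite (sum_weight_mul _ _ t0); apply: eq_bigr => m _.
rewrite (@sum_weight_qinv_sq _ _ (qweight p M)) // mulr_sumr; apply: eq_bigr => n _.
rewrite qfact_invE /qweight /qexp; case: leqP => _; last by rewrite !(mulr0, mul0r).
rewrite exprD exprM -/p; field.
by rewrite !(qpoch_neq0 hp) (qpoch_neq0 hq).
Qed.

End LeftHandSide.

Theorem theorem4p6 (F : fieldType) (q : F)
    (hq : forall k : nat, (0 < k)%N -> q ^+ k != 1) (M : nat) :
  \sum_(m \in [set: nat]) \sum_(n \in [set: nat])
     (q ^+ (Q m n + m + 3 * n) * qpoch (q ^+ 3) (q ^+ 3) M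
        / (qpoch q q m * qpoch (q ^+ 3) (q ^+ 3) n)
        * qfact_inv (q ^+ 3) (M%:Z - 2%:Z * n%:Z - m%:Z))
  + \sum_(m \in [set: nat]) \sum_(n \in [set: nat])
     (q ^+ (Q m n + 3 * m + 6 * n + 1) * qpoch (q ^+ 3) (q ^+ 3) M
        / (qpoch q q m * qpoch (q ^+ 3) (q ^+ 3) n)
        * qfact_inv (q ^+ 3) (M%:Z - 2%:Z * n%:Z - m%:Z))
  = \sum_(j \in [set j : int | - M%:Z - 1 <= j <= M%:Z])
     (q ^ (3%:Z * j ^+ 2 + 2%:Z * j)
        * qbinom (q ^+ 3) (2%:Z * M%:Z + 1) (M%:Z - j)).
Proof.
have hp := expr3X_neq1 hq.
rewrite !fsum_qfact_inv fsum_qbinom.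
have [q0|q0] := eqVneq q 0.
  (* At q = 0 both sides equal 1: the term m = n = 0 of the first sum survives on the left, the term
     j = 0 on the right. *)
  have poch1 n : qpoch (q ^+ 3) (q ^+ 3) n = 1.
    by rewrite /qpoch big1 // => i _; rewrite q0 expr0n mul0r subr0.
  rewrite [X in _ + X]big1 ?addr0 => [|m _]; last first.
    by rewrite big1 // => n _; rewrite q0 addn1 expr0n !mul0r.
  rewrite (bigD1 ord0) //= [X in _ + X]big1 ?addr0 => [|m m0]; last first.
    rewrite big1 // => n _; rewrite q0 expr0n /Q !addn_eq0.
    by rewrite -[nat_of_ord m == 0%N]/(m == ord0) (negPf m0) andbF !mul0r.
  rewrite (bigD1 ord0) //= [X in _ + X]big1 ?addr0 => [|n n0]; last first.
    rewrite q0 expr0n !addn_eq0 !muln_eq0.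
    by rewrite -[nat_of_ord n == 0%N]/(n == ord0) (negPf n0) andbF !mul0r.
  (* The index n = M is j = 0, the only integer root of 3j^2 + 2j. *)
  have lt_M : (M < M + M.+2)%N by lia.
  rewrite (bigD1 (Ordinal lt_M)) //= big1 ?addr0 => [|n nM]; last first.
    rewrite q0 exp0rz; case: eqP; rewrite ?mul0r // => E; exfalso.
    move/eqP: nM; apply; apply: val_inj => /=; nia.
  rewrite subrr /gauss !poch1 [qpoch q q 0]qpoch0 ifT; last by lia.
  by rewrite /Q !mulr1 !invr1 !mulr1.
rewrite (rhs_gauss_square_sum hq q0).
rewrite !(gauss_square_sumE hp (expf_neq0 3 q0)) ?invr_eq0 ?expf_neq0 //.
rewrite [in RHS]mulr_sumr -[RHS]big_split /=.
transitivity (\sum_(r < M.+1) qweight (q ^+ 3) M r *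
  (qexp q 1 * qinv_sq (q ^+ 3) 1 +
   fps_const q * (qexp q (q ^+ 2) * qinv_sq (q ^+ 3) (q ^+ 3))) r); last first.
  rewrite series_identity //; apply: eq_bigr => r _.
  by rewrite fpsD fpsCM; ring.
under [RHS]eq_bigr do rewrite fpsD fpsCM mulrDr mulrCA.
rewrite big_split /= -mulr_sumr !(sum_qweight_double hq); congr (_ + _).
  apply: eq_bigr => m _; apply: eq_bigr => n _; rewrite !expr1n !mulr1.
  congr (q ^+ _ * _ / _ * _).
  (* Here Q(m,n) + m + 3n = 3 C(m+2n+1,2) + C(m,2). *)
  rewrite /Q -!mulnn !binS !bin1 -addnn !binD2.
  by have := mulnn_bin2 m; have := mulnn_bin2 n; lia.
rewrite mulr_sumr; apply: eq_bigr => m _.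
rewrite mulr_sumr; apply: eq_bigr => n _.
(* Compared with the first sum, w = q^2, c = p and the outer q add 2m + 3n + 1 to the exponent. *)
rewrite -!exprM !mulrA -exprS -!exprD.
congr (q ^+ _ * _ / _ * _).
rewrite /Q -!mulnn !binS !bin1 -addnn !binD2.
by have := mulnn_bin2 m; have := mulnn_bin2 n; lia.
Qed.
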